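(* Let $q$ be a prime power, $m,r\ge1$, $V_{m,r}=\{f\in\mathbb{F}_q[x_1,\ldots,x_m]:\deg f\le r\}$, and let $V$ be an $\mathbb{F}_q$-subspace of $V_{m,r}$ that has property $( * )$. Then for every $\mathcal{P}\subseteq\mathbb{F}_q^{m+1}$ and every $\mathcal{L}\subseteq V$, $$\left|I(\mathcal{P},\mathcal{L})-\frac{|\mathcal{P}||\mathcal{L}|}{q}\right|\le q^{(\dim V-1)/2}\sqrt{|\mathcal{P}||\mathcal{L}|}.$$
   Context: A subspace $V$ of $\mathbb{F}_q[x_1,\ldots,x_m]$ has property $( * )$ if $V$ has a basis of monomials $\{x_1^{i_1}\cdots x_m^{i_m}:(i_1,\ldots,i_m)\in\mathcal{I}\}$, where $\mathcal{I}$ is a finite subset of $\mathbb{N}^m$ such that (i) $(0,\ldots,0)\in\mathcal{I}$, and (ii) there exist integers $k_1,\ldots,k_m$ with $(k_1,0,\ldots,0),(0,k_2,0,\ldots,0),\ldots,(0,\ldots,0,k_m)\in\mathcal{I}$ and $\gcd(k_i,q-1)=1$ for each $i$. A point $v=(v_1,\ldots,v_{m+1})\in\mathbb{F}_q^{m+1}$ is incident to $f$ if $f(v_1,\ldots,v_m)=v_{m+1}$, and $I(\mathcal{P},\mathcal{L})=|\{(v,f)\in\mathcal{P}\times\mathcal{L}: f(v_1,\ldots,v_m)=v_{m+1}\}|$.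
   Formalization: In property ( * ) the integers k_i are required to be positive; this is automatic for q > 2, but for q = 2 the choice k_i = 0 would be allowed and the inequality fails (m = 3, V = {0,1}, L = {0}, P = F_2^3 x {0}). *)

(* Defs.v *)
From HB Require Import structures.
From mathcomp Require Import all_boot all_order all_algebra.
From mathcomp Require Import finmap mpoly.

Set Implicit Arguments.
Unset Strict Implicit.
Unset Printing Implicit Defensive.

Import Order.TTheory GRing.Theory Num.Theory.

Local Open Scope ring_scope.

Section BoundedDegree.

Variables (m : nat) (K : fieldType) (r : nat).

(* [msize p] is the total degree plus one, and [0] for [p = 0]. *)
Definition deg_le : {pred {mpoly K[m]}} := [pred p | (msize p <= r.+1)%N].

Lemma deg_leP (p : {mpoly K[m]}) :
  reflect (forall u, (r < mdeg u)%N -> p@_u = 0) (p \in deg_le).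
Proof.
rewrite inE; apply: (iffP idP) => [lep u ltu|h].
  by apply: memN_msupp_eq0; apply: msize_mdeg_ge; apply: leq_trans ltu.
rewrite msizeE big_seq; elim/big_ind: _ => // [x y|u].
  by rewrite geq_max => -> ->.
rewrite mcoeff_msupp ltnS; apply: contraR; rewrite -ltnNge => /h ->.
by rewrite eqxx.
Qed.

Lemma deg_le_submod : submod_closed deg_le.
Proof.
split=> [|c p q /deg_leP hp /deg_leP hq]; apply/deg_leP => u ltu.
  by rewrite mcoeff0.
by rewrite mcoeffD mcoeffZ hp // hq // mulr0 addr0.
Qed.

HB.instance Definition _ :=
  GRing.isSubmodClosed.Build K {mpoly K[m]} deg_le deg_le_submod.

Record mpoly_le :=
  MPolyLe { mpoly_of_le :> {mpoly K[m]}; _ : mpoly_of_le \in deg_le }.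

HB.instance Definition _ := [isSub for mpoly_of_le].
HB.instance Definition _ := [Choice of mpoly_le by <:].
HB.instance Definition _ := [SubChoice_isSubLmodule of mpoly_le by <:].

Lemma mpoly_le_vecaxiom : vector_axiom #|{: 'X_{1..m < r.+1}}| mpoly_le.
Proof.
pose mon (i : 'I_#|{: 'X_{1..m < r.+1}}|) : 'X_{1..m} := bmnm (enum_val i).
exists (fun p : mpoly_le => \row_i (p : {mpoly K[m]})@_(mon i)) => [c p q|].
  by apply/rowP => i; rewrite !mxE /= mcoeffD mcoeffZ.
pose g (a : 'rV[K]_#|{: 'X_{1..m < r.+1}}|) : {mpoly K[m]} :=
  \sum_i a 0 i *: 'X_[mon i].
have mon_inj : injective mon by move=> i j /val_inj /enum_val_inj.
have gmon a i : (g a)@_(mon i) = a 0 i.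
  rewrite /g raddf_sum (bigD1 i) //= mcoeffZ mcoeffX eqxx mulr1.
  rewrite big1 ?addr0 // => j ne_ji.
  by rewrite mcoeffZ mcoeffX (inj_eq mon_inj) (negbTE ne_ji) mulr0.
have gle a : g a \in deg_le.
  apply/deg_leP => u ltu; rewrite /g raddf_sum big1 //= => i _.
  rewrite mcoeffZ mcoeffX; case: eqP => [eq_u|_]; last by rewrite mulr0.
  by have := bmdeg (enum_val i); rewrite -/(mon i) eq_u ltnS leqNgt ltu.
exists (fun a => MPolyLe (gle a)) => [p|a]; last first.
  by apply/rowP => i; rewrite mxE /= gmon.
apply/val_inj/mpolyP => u /=; case: (leqP (mdeg u) r) => [leu|ltu].
  have -> : u = mon (enum_rank (BMultinom (leu : (mdeg u < r.+1)%N))).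
    by rewrite /mon enum_rankK.
  by rewrite gmon mxE.
by rewrite (deg_leP _ (gle _)) // (deg_leP _ (valP p)).
Qed.

HB.instance Definition _ :=
  Lmodule_hasFinDim.Build K mpoly_le mpoly_le_vecaxiom.

End BoundedDegree.

Section Incidences.

Variables (m : nat) (F : finFieldType) (r : nat).

(* [0 < k i] follows from coprimality unless #|F| = 2: there gcd(0, 1) = 1, so
   without it the constant monomial alone would qualify. *)
Definition property_star (V : {vspace mpoly_le m F r}) : Prop :=
  exists I : {fset 'X_{1..m}},
    [/\ exists2 b : seq (mpoly_le m F r), basis_of V b &
          [seq mpoly_of_le p | p <- b] = [seq 'X_[u] | u <- enum_fset I],
        0%MM \in I
      & exists k : 'I_m -> nat, forall i,
          [/\ (0 < k i)%N, (U_(i) *+ k i)%MM \in I & coprime (k i) #|F|.-1]].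

Definition incident (v : 'rV[F]_m.+1) (f : mpoly_le m F r) : bool :=
  (mpoly_of_le f).@[fun i : 'I_m => v 0 (widen_ord (leqnSn m) i)]
    == v 0 ord_max.

Definition incidences (P : {fset 'rV[F]_m.+1}) (L : {fset mpoly_le m F r}) :
    nat :=
  #|` [fset vf in (P `*` L)%fset | incident vf.1 vf.2]%fset |.

End Incidences.

(* Main.v *)
Require Import Defs.
From mathcomp Require Import all_boot all_order all_algebra.
From mathcomp Require Import finmap mpoly finfield ring lra.

Import Order.TTheory GRing.Theory Num.Theory.

Local Open Scope ring_scope.

(** Two points with distinct projections to the first [m] coordinates are
    separated by some [x_i^k_i], since [x -> x^k_i] permutes the field; with the
    constants, evaluation at them maps [V] onto [F^2], so their incidences with
    a random [f] in [V] are independent.  Points with equal projections are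
    incident to disjoint sets of polynomials, hence negatively correlated.  So
    the number of points of [P] incident to a random [f] has variance at most
    [|P| / q], and Cauchy-Schwarz over [L] concludes. *)

(** Cauchy-Schwarz against the constant 1, obtained from the nonnegativity of the squared deviations
    of [g] from its mean [S / n] over [A]. *)
Lemma sqr_sum_le_card (R : realFieldType) (T : finType) (A : {pred T})
    (g : T -> R) :
  (\sum_(x in A) g x) ^+ 2 <= #|A|%:R * \sum_(x in A) g x ^+ 2.
Proof.
have [A0|A0] := posnP #|A|.
  rewrite !big_pred0 ?expr0n ?mulr0 // => x; exact: (card0_eq A0).
have cA : (0 : R) < #|A|%:R by rewrite ltr0n.
set S := \sum_(x in A) g x; set n : R := #|A|%:R in cA *.
have : 0 <= \sum_(x in A) (g x - S / n) ^+ 2.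
  by apply: sumr_ge0 => x _; apply: sqr_ge0.
have -> : \sum_(x in A) (g x - S / n) ^+ 2 =
    \sum_(x in A) g x ^+ 2 - S ^+ 2 / n.
  rewrite (eq_bigr (fun x => g x ^+ 2 + (- (2 * (S / n)) * g x + (S / n) ^+ 2)));
    last by move=> x _; ring.
  rewrite !big_split /= -mulr_sumr -/S sumr_const -[_ *+ #|A|]mulr_natl -/n.
  by field; rewrite gt_eqF.
by rewrite subr_ge0 ler_pdivrMr // mulrC.
Qed.

(* For a line chosen uniformly in [D], [deg2] says that the incidences with two
   points are independent or negatively correlated. *)
Lemma incidence_deviation (R : realFieldType) (T U : finType)
    (inc : T -> U -> bool) (D : {pred U}) (c : R)
    (deg1 : forall v, #|[pred f in D | inc v f]|%:R = c * #|D|%:R)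
    (deg2 : forall v w, v != w ->
       #|[pred f in D | inc v f && inc w f]|%:R <= c ^+ 2 * #|D|%:R)
    (P : {pred T}) (L : {pred U}) (sLD : {subset L <= D}) :
  (#|[pred x : T * U | [&& x.1 \in P, x.2 \in L & inc x.1 x.2]]|%:R
     - c * (#|P|%:R * #|L|%:R)) ^+ 2 <= c * #|D|%:R * (#|P|%:R * #|L|%:R).
Proof.
have sumE (b : pred U) : \sum_(f in D) (b f)%:R = #|[pred f in D | b f]|%:R :> R.
  rewrite -sum1_card natr_sum big_mkcondr.
  by apply: eq_bigr => f _; case: (b f).
(* [k f] is the number of points of [P] on [f]; by [deg1] its mean over [D] is [c * #|P|], so [g] is
   the centred count. *)
pose k (f : U) : R := \sum_(v in P) (inc v f)%:R.
pose g f := k f - c * #|P|%:R.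
have -> : #|[pred x : T * U | [&& x.1 \in P, x.2 \in L & inc x.1 x.2]]|%:R
    - c * (#|P|%:R * #|L|%:R) = \sum_(f in L) g f.
  rewrite sumrB sumr_const -[(c * _) *+ _]mulr_natl.
  congr (_ - _); last by ring.
  rewrite -sum1_card natr_sum.
  rewrite exchange_big pair_big /= [RHS]big_mkcond [LHS]big_mkcond /=.
  apply: eq_bigr => -[v f] _; rewrite !inE /=.
  by do !case: (_ \in _) => //=; case: (inc _ _).
have sum_k : \sum_(f in D) k f = c * #|D|%:R * #|P|%:R.
  rewrite exchange_big /= (eq_bigr (fun=> c * #|D|%:R)).
    by rewrite sumr_const -[LHS]mulr_natr.
  by move=> v _; rewrite sumE deg1.
have sum_k2 : \sum_(f in D) k f ^+ 2 <=
    c * #|D|%:R * #|P|%:R + c ^+ 2 * #|D|%:R * #|P|%:R ^+ 2.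
  have -> : \sum_(f in D) k f ^+ 2 =
     \sum_(v in P) \sum_(w in P) #|[pred f in D | inc v f && inc w f]|%:R.
    transitivity (\sum_(f in D) \sum_(v in P) \sum_(w in P)
        (inc v f && inc w f)%:R : R).
      apply: eq_bigr => f _; rewrite expr2 mulr_suml; apply: eq_bigr => v _.
      by rewrite mulr_sumr; apply: eq_bigr => w _; rewrite -natrM mulnb.
    rewrite exchange_big; apply: eq_bigr => v _.
    by rewrite exchange_big; apply: eq_bigr => w _; rewrite sumE.
  apply: (@le_trans _ _ (\sum_(v in P)
      (c * #|D|%:R + c ^+ 2 * #|D|%:R * #|P|%:R))); last first.
    by rewrite sumr_const -[_ *+ _]mulr_natr mulrDl -[X in _ + X]mulrA -expr2.
  (* The diagonal term [w = v] is exact by [deg1]; the others fall under [deg2]. *)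
  apply: ler_sum => v Pv; rewrite (bigD1 v) //= lerD //.
    rewrite -(deg1 v) ler_nat; apply/eq_leq/eq_card => f.
    by rewrite !inE andbb.
  (* The bound is spread evenly over [w] in [P]; its nonnegative share at [w = v] is discarded. *)
  rewrite mulr_natr -sumr_const [leRHS](bigD1 v) //=.
  rewrite ler_wpDl ?(mulr_ge0 (sqr_ge0 _)) //.
  by apply: ler_sum => w /andP[_ nwv]; apply: deg2; rewrite eq_sym.
have var_k : \sum_(f in D) g f ^+ 2 <= c * #|D|%:R * #|P|%:R.
  rewrite (eq_bigr (fun f => k f ^+ 2 +
      (- (2 * c * #|P|%:R) * k f + (c * #|P|%:R) ^+ 2))); last first.
    by move=> f _; rewrite /g; ring.
  rewrite !big_split /= -mulr_sumr sum_k sumr_const -[_ *+ #|D|]mulr_natl.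
  by move: sum_k2; lra.
(* After Cauchy-Schwarz over [L], the sum of squares only grows when extended from [L] to [D]. *)
apply: le_trans (sqr_sum_le_card _ _ _ _) _.
rewrite mulrA [leRHS]mulrC ler_wpM2l //; apply: le_trans var_k.
rewrite [leLHS]big_mkcond [leRHS]big_mkcond /=; apply: ler_sum => f _.
by have [/sLD->//|_] := boolP (f \in L); case: ifP; rewrite ?sqr_ge0.
Qed.

(** Bezout gives [u * k = v * (q - 1) + 1] with [q = #|F|]; since [x ^+ q = x] also at [x = 0],
    raising to the power [u] inverts the map. *)
Lemma expf_coprime_inj (F : finFieldType) (k : nat) :
  (0 < k)%N -> coprime k #|F|.-1 -> injective (fun x : F => x ^+ k).
Proof.
move=> k_gt0 /eqP co_k; have [u v def_uv _] := egcdnP #|F|.-1 k_gt0.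
suff expK (x : F) : x ^+ k ^+ u = x.
  by exact: (@can_inj _ _ _ (fun y => y ^+ u) expK).
rewrite -exprM mulnC def_uv co_k addn1; elim: v {def_uv} => // v IHv.
rewrite mulSn -addnS exprD IHv -exprSr prednK ?expf_card //.
exact: ltnW (finNzRing_gt1 F).
Qed.

Lemma subr_add_eq (U : zmodType) (x y z : U) : (z - y + x == z) = (x == y).
Proof. by rewrite addrAC subr_eq (inj_eq (addrI z)). Qed.

(** Translation by an element of [V] matches any two fibers of [phi], so [V] is partitioned into
    [#|U|] fibers of equal size. *)
Lemma card_fiber (F : finFieldType) (vT : vectType F) (U : finType)
    (V : {vspace finvect_type vT}) (phi : finvect_type vT -> U) :
  (forall y z, exists2 f, f \in V & forall g,
     (phi (f + g) == z) = (phi g == y)) ->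
  forall y, (#|U| * #|[pred f in V | phi f == y]|)%N = #|V|.
Proof.
move=> translate y.
have card_eq z : #|[pred f in V | phi f == z]| = #|[pred f in V | phi f == y]|.
  have [f Vf phi_f] := translate y z.
  rewrite -!sum1_card (reindex_inj (addrI f)); apply: eq_bigl => g.
  by rewrite !inE rpredDl // phi_f.
rewrite -[RHS]sum1_card (partition_big phi predT) //=.
rewrite (eq_bigr (fun=> #|[pred f in V | phi f == y]|)) ?sum_nat_const //.
by move=> z _; rewrite sum1_card card_eq.
Qed.

Section Evaluation.
Variables (m : nat) (F : finFieldType) (r : nat).

Definition point_eval (v : 'rV[F]_m.+1) (f : mpoly_le m F r) : F :=
  (mpoly_of_le f).@[fun i : 'I_m => v 0 (widen_ord (leqnSn m) i)].

Lemma point_evalD v : {morph point_eval v : f g / f + g}.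
Proof. by move=> f g; rewrite /point_eval /= mevalD. Qed.

Lemma point_evalZ v a f : point_eval v (a *: f) = a * point_eval v f.
Proof. by rewrite /point_eval /= mevalZ. Qed.

Variable V : {vspace mpoly_le m F r}.
Hypothesis Vstar : property_star V.

Lemma star_const : exists2 e, e \in V & forall v, point_eval v e = 1.
Proof.
have [I [[b bV def_b] I0 _]] := Vstar.
have : 'X_[0%MM] \in [seq mpoly_of_le p | p <- b] by rewrite def_b map_f.
case/mapP => p pb def_p; exists p; first exact: basis_mem bV pb.
by move=> v; rewrite /point_eval -def_p mpolyX0 meval1.
Qed.

Lemma star_separate (v w : 'rV[F]_m.+1) (i : 'I_m) :
    v 0 (widen_ord (leqnSn m) i) != w 0 (widen_ord (leqnSn m) i) ->
  exists2 p, p \in V & point_eval v p != point_eval w p.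
Proof.
move=> vwi; have [I [[b bV def_b] _ [k Ik]]] := Vstar.
have [k_gt0 kI co_k] := Ik i.
have : 'X_[(U_(i) *+ k i)%MM] \in [seq mpoly_of_le p | p <- b].
  by rewrite def_b map_f.
case/mapP => p pb def_p; exists p; first exact: basis_mem bV pb.
rewrite /point_eval -def_p -mpolyXn !rmorphXn /= !mevalXU.
by rewrite (inj_eq (expf_coprime_inj _ _ k_gt0 co_k)).
Qed.

(** The same subspace inside a finite type, so that its elements can be counted. *)
Let Vf : {vspace finvect_type (mpoly_le m F r)} := V.

Lemma card_incident v :
  (#|F| * #|[pred f in Vf | incident v f]| = #|Vf|)%N.
Proof.
apply: (card_fiber _ _ _ Vf (point_eval v)) => y z.
have [e Ve e1] := star_const; exists ((z - y) *: e); first exact: rpredZ.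
by move=> g; rewrite point_evalD point_evalZ e1 mulr1 subr_add_eq.
Qed.

Lemma card_incident2 v w : v != w ->
  (#|F| ^ 2 * #|[pred f in Vf | incident v f && incident w f]| <= #|Vf|)%N.
Proof.
move=> neq_vw.
have [/existsP[i vwi]|/existsPn eq_vw] :=
    boolP [exists i : 'I_m, v 0 (widen_ord (leqnSn m) i)
                       != w 0 (widen_ord (leqnSn m) i)]; last first.
  (* Equal projections: an [f] incident to both points would force equal last coordinates, hence
     [v = w]. *)
  rewrite [X in (_ * X)%N]eq_card0 ?muln0 // => f; rewrite !inE.
  apply: contraNF neq_vw => /and3P[_ /eqP fv /eqP fw].
  apply/eqP/rowP => j; case: (unliftP ord_max j) => [i|] ->; last first.
    rewrite -fv -fw; apply: meval_eq => i; exact/eqP/negPn.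
  have -> : lift ord_max i = widen_ord (leqnSn m) i.
    by apply/val_inj; rewrite /= /bump leqNgt ltn_ord.
  exact/eqP/negPn.
have [e Ve e1] := star_const; have [p Vp] := star_separate _ _ _ vwi.
rewrite -subr_eq0 => dp_neq0.
(* For separated points equality holds: [#|F| ^ 2] counts the value pairs, and all pairs have
   equally large fibers. *)
rewrite expnS expn1 -card_prod.
rewrite -(card_fiber _ _ _ Vf (fun f => (point_eval v f, point_eval w f)) _
  (v 0 ord_max, w 0 ord_max)).
  exact: leqnn.
move=> [y1 y2] [z1 z2].
pose a := z1 - y1; pose b := z2 - y2.
(* The translation must take the values [a] at [v] and [b] at [w]: [t] scales [p] to produce the
   difference [a - b], and a constant then corrects the value at [v]. *)
pose t := (a - b) / (point_eval v p - point_eval w p).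
exists (t *: p + (a - t * point_eval v p) *: e); first by rewrite rpredD ?rpredZ.
move=> g; rewrite !xpair_eqE !point_evalD !point_evalZ !e1 !mulr1.
have -> : t * point_eval w p + (a - t * point_eval v p) = b.
  by rewrite /t; field.
by rewrite [t * _ + _]addrC subrK !subr_add_eq.
Qed.

End Evaluation.

Lemma incidencesE (m : nat) (F : finFieldType) (r : nat)
    (P : {fset 'rV[F]_m.+1}) (L : {fset mpoly_le m F r}) :
  incidences P L =
    #|[pred x : 'rV[F]_m.+1 * finvect_type (mpoly_le m F r) |
        [&& x.1 \in P, x.2 \in L & incident x.1 x.2]]|.
Proof.
set S := [fset vf in (P `*` L)%fset | incident vf.1 vf.2]%fset.
pose T := ('rV[F]_m.+1 * finvect_type (mpoly_le m F r))%type.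
rewrite -[LHS](@card_uniqP T (enum_fset S) (fset_uniq _)).
apply: eq_card => -[v f].
by rewrite !inE /= andbA.
Qed.

Theorem theorem1p4 (R : rcfType) (F : finFieldType) (q : nat) (hq : #|F| = q)
    (m r : nat) (hm : (1 <= m)%N) (hr : (1 <= r)%N)
    (V : {vspace mpoly_le m F r}) (hV : property_star V)
    (P : {fset 'rV[F]_m.+1}) (L : {fset mpoly_le m F r})
    (hL : {subset L <= V}) :
  `|(incidences P L)%:R - (#|` P |%:R * #|` L |%:R) / q%:R| <=
    Num.sqrt (q%:R : R) ^ ((\dim V)%:Z - 1) *
    Num.sqrt (#|` P |%:R * #|` L |%:R).
Proof.
pose Vf : {vspace finvect_type (mpoly_le m F r)} := V.
pose Lf : {pred finvect_type (mpoly_le m F r)} := [pred f | f \in L].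
have q_neq0 : (q%:R : R) != 0 by rewrite pnatr_eq0 -hq -lt0n ltnW ?finNzRing_gt1.
have deg1 v : #|[pred f in Vf | incident v f]|%:R = (q%:R : R)^-1 * #|Vf|%:R.
  by rewrite -(card_incident _ _ _ _ hV v) hq natrM mulKf.
have deg2 v w : v != w -> #|[pred f in Vf | incident v f && incident w f]|%:R
     <= (q%:R : R)^-1 ^+ 2 * #|Vf|%:R.
  move=> /(card_incident2 _ _ _ _ hV); rewrite hq -(ler_nat R) natrM natrX exprVn.
  by rewrite ler_pdivlMl // exprn_gt0 // lt0r q_neq0 ler0n.
(* [V] contains a polynomial with value 1 everywhere, so the integer exponent [\dim V - 1] is a
   natural number. *)
have dimV_gt0 : (0 < \dim V)%N.
  rewrite lt0n dimv_eq0; have [e Ve e1] := star_const _ _ _ _ hV.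
  apply: contraL Ve => /eqP->; rewrite memv0; apply/eqP => e0.
  by have /eqP := e1 0; rewrite e0 /point_eval meval0 eq_sym oner_eq0.
have := @incidence_deviation R _ _ _ _ _ deg1 deg2 [pred v | v \in P] Lf hL.
have -> : #|[pred v | v \in P]| = #|` P| by apply/card_uniqP/fset_uniq.
have -> : #|Lf| = #|` L|
  by apply/(@card_uniqP (finvect_type (mpoly_le m F r)) (enum_fset L))/fset_uniq.
rewrite -incidencesE card_vspace hq [X in _ - X]mulrC.
set dev := _ - _; set PL := #|` P|%:R * _.
(* With [c = 1 / q] and [q ^ \dim V] elements in [V], the factor [c * #|Vf|] becomes
   [q ^ (\dim V - 1)]; the claim is the square root of this bound. *)
rewrite -(prednK dimV_gt0) expnS natrM mulKf // => dev2.
have -> : (\dim V).-1.+1%:Z - 1 = (\dim V).-1 by rewrite intS addrAC subrr add0r.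
rewrite -[leRHS]ger0_norm ?mulr_ge0 ?exprn_ge0 ?sqrtr_ge0 //.
rewrite -ler_sqr ?nnegrE // !real_normK ?num_real //.
rewrite exprMn exprAC !sqr_sqrtr ?ler0n ?mulr_ge0 //.
by move: dev2; rewrite natrX.
Qed.
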